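(* Let $\Sigma=(A,B,C,D)$ be a system satisfying the standing assumptions, Assumption 1 and Assumption 2 of the context. Let $\dim \mathcal{V}^\star_g=n-p$, and let $\lambda_1,\ldots,\lambda_p\in\Lambda_g\setminus\mathcal{Z}$. Then Problem 3 (for $\lambda_1,\ldots,\lambda_p$) is solvable if and only if for every subset $S\subseteq\{1,\ldots,p\}$ $$\dim\Big(\mathcal{V}^\star_g+\sum_{j\in S}\mathcal{R}^\star_j(\lambda_j)\Big)\ \ge\ (n-p)+\mathrm{card}(S).$$
   Context: The system $\Sigma$ is $\mathcal{D}x=Ax+Bu$, $y=Cx+Du$, with real constant matrices, $x(t)\in\mathcal{X}=\mathbb{R}^n$, $u(t)\in\mathcal{U}=\mathbb{R}^m$, $y(t)\in\mathcal{Y}=\mathbb{R}^p$. Either continuous time ($t\in\mathbb{T}=\mathbb{R}^+$, $\mathcal{D}x=\dot x$, $\mathbb{C}_g$ = open left half-plane, $\Lambda_g=(-\infty,0)$) or discrete time ($t\in\mathbb{T}=\mathbb{N}$, $\mathcal{D}x(t)=x(t+1)$, $\mathbb{C}_g$ = open unit disc, $\Lambda_g=[0,1)$, convention $0^0=1$). A matrix is asymptotically stable if its spectrum lies in $\mathbb{C}_g$. Standing assumptions: the columns of $\begin{bmatrix} B \\ D \end{bmatrix}$ are linearly independent, and the rows of $[\,C\ \ D\,]$ are linearly independent. Rosenbrock matrix: $P_\Sigma(\lambda)=\begin{bmatrix} A-\lambda I_n & B \\ C & D \end{bmatrix}$. The set $\mathcal{Z}$ of invariant zeros of $\Sigma$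 is the set of $\lambda\in\mathbb{C}$ at which $\mathrm{rank}\,P_\Sigma(\lambda)$ is smaller than its normal rank; algebraic multiplicities are those of the zeros as roots of the product of the nonzero polynomials of the Smith form of $P_\Sigma$. Minimum-phase invariant zeros are those in $\mathbb{C}_g$. Assumption 1: $\Sigma$ is right invertible (i.e. $P_\Sigma(\lambda)$ has full row rank $n+p$ for all but finitely many $\lambda$), $(A,B)$ is stabilisable, and $\Sigma$ has no invariant zero at $0$ (continuous time), respectively at $1$ (discrete time). Assumption 2: all minimum-phase invariant zeros of $\Sigma$ have algebraic multiplicity one. $\mathcal{V}^\star_g$ is the largest subspace $\mathcal{V}\subseteq\mathcal{X}$ for which there is $F\in\mathbb{R}^{m\times n}$ with $(A+BF)\mathcal{V}\subseteq\mathcal{V}\subseteq\ker(C+DF)$ and $\sigma(A+BF\,|\,\mathcal{V})\subset\mathbb{C}_g$. For $j\in\{1,\ldots,p\}$, $C_{(j)},D_{(j)}$ are $C,D$ with the $j$-th row deleted, and for $\mu\in\mathbb{R}\setminus\mathcal{Z}$, $\mathcal{R}^\star_j(\mu)=\{v\in\mathcal{X}\mid \exists w\in\mathcal{U}:\ (A-\mu I_n)v+Bw=0,\ C_{(j)}v+D_{(j)}w=0\}$. Tracking: for a constant reference $r\in\mathcal{Y}$ choose $x_{ss},u_{ss}$ with $0=Ax_{ss}+Bu_{ss}$ (continuous) or $x_{ss}=Ax_{ss}+Bu_{ss}$ (discrete), and $r=Cx_{ss}+Du_{ss}$. Under $u=F(x-x_{ss})+u_{ss}$, with $\xi=x-x_{ss}$,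 one has $\mathcal{D}\xi=(A+BF)\xi$ and the tracking error is $\epsilon=y-r=(C+DF)\xi$. Problem 3 (for given $\lambda_1,\ldots,\lambda_p\in\Lambda_g$): find a real feedback matrix $F$ such that $A+BF$ is asymptotically stable and, for all initial conditions and all step references $r$, $\epsilon(t)=[\beta_1e^{\lambda_1t},\ldots,\beta_pe^{\lambda_pt}]^\top$ (continuous) or $\epsilon(t)=[\beta_1\lambda_1^t,\ldots,\beta_p\lambda_p^t]^\top$ (discrete), for some real $\beta_k$ depending only on $\xi(0)$ (possibly zero). *)

(* Defs.v *)
(* MathComp / MathComp-Analysis; the real numbers are an arbitrary
   [R : realType] and the complex numbers are [R[i]]. *)
From HB Require Import structures.
From mathcomp Require Import all_boot all_order all_algebra.
From mathcomp Require Import all_classical all_reals all_analysis.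
From mathcomp Require Import complex.

Set Implicit Arguments.
Unset Strict Implicit.
Unset Printing Implicit Defensive.

Import Order.TTheory GRing.Theory Num.Theory.
Import numFieldNormedType.Exports.

Local Open Scope classical_set_scope.
Local Open Scope ring_scope.

Inductive time_domain := ContinuousTime | DiscreteTime.

Record lti_system (R : realType) (n m p : nat) := LtiSystem {
  sysA : 'M[R]_n;
  sysB : 'M[R]_(n, m);
  sysC : 'M[R]_(p, n);
  sysD : 'M[R]_(p, m) }.

Definition cplx (R : realType) (a b : nat) (M : 'M[R]_(a, b)) : 'M[R[i]]_(a, b) :=
  map_mx (real_complex R) M.

(* Used at a real or complex point [l] and, over [{poly R}], at [l := 'X]. *)
Definition rosenbrock (K : comNzRingType) (n m p : nat) (A : 'M[K]_n)
    (B : 'M[K]_(n, m)) (C : 'M[K]_(p, n)) (D : 'M[K]_(p, m)) (l : K) :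
    'M[K]_(n + p, n + m) :=
  block_mx (A - l%:M) B C D.

(* [D] is diagonal (possibly rectangular), its nonzero diagonal entries are
   monic, each diagonal entry divides the later ones (so the zero ones come
   last), and [D] is unimodularly equivalent to [P]. *)
Definition is_smith_form (K : fieldType) (a b : nat)
    (P D : 'M[{poly K}]_(a, b)) : Prop :=
  [/\ is_diag_mx D,
      forall i j, D i j != 0 -> D i j \is monic,
      forall (i i' : 'I_a) (j j' : 'I_b), i = j :> nat -> i' = j' :> nat -> (i <= i')%N ->
        (D i j %| D i' j')%R
    & exists U V, [/\ U \in unitmx, V \in unitmx & D = U *m P *m V]].

(* For a diagonal [D], the product of its nonzero diagonal entries. *)
Definition nonzero_prod (K : fieldType) (a b : nat) (D : 'M[{poly K}]_(a, b)) :
    {poly K} :=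
  \prod_i \prod_(j | D i j != 0) D i j.

(* Matrix, in the basis [vbasis V], of the restriction to [V] of [v |-> M v];
   meaningful when [V] is [M]-invariant. *)
Definition restriction (K : fieldType) (n : nat) (M : 'M[K]_n)
    (V : {vspace 'cV[K]_n}) : 'M[K]_(\dim V) :=
  \matrix_(i, j) coord (vbasis V) i (M *m (vbasis V)`_j).

Section System.
Variables (R : realType) (n m p : nat).
Variables (tm : time_domain) (S : lti_system R n m p).

Local Notation A := (sysA S).
Local Notation B := (sysB S).
Local Notation C := (sysC S).
Local Notation D := (sysD S).

Definition Cg (z : R[i]) : Prop :=
  match tm with
  | ContinuousTime => complex.Re z < 0
  | DiscreteTime => `|z| < 1
  end.

Definition Lambdag (l : R) : Prop :=
  match tm with
  | ContinuousTime => l < 0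
  | DiscreteTime => 0 <= l < 1
  end.

Definition spectrum_in_Cg (k : nat) (M : 'M[R]_k) : Prop :=
  forall z : R[i], eigenvalue (cplx M) z -> Cg z.

Definition asymptotically_stable (M : 'M[R]_n) : Prop := spectrum_in_Cg M.

Definition standing_assumptions : Prop :=
  row_free (col_mx B D)^T /\ row_free (row_mx C D).

Definition rosenbrock_poly : 'M[{poly R}]_(n + p, n + m) :=
  rosenbrock (map_mx polyC A) (map_mx polyC B) (map_mx polyC C)
    (map_mx polyC D) 'X.

Definition rosenbrock_at (z : R[i]) : 'M[R[i]]_(n + p, n + m) :=
  rosenbrock (cplx A) (cplx B) (cplx C) (cplx D) z.

(* The rank over the field of rational functions. *)
Definition normal_rank : nat :=
  \rank (map_mx (@tofrac {poly R}) rosenbrock_poly).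

Definition invariant_zero (z : R[i]) : Prop :=
  (\rank (rosenbrock_at z) < normal_rank)%N.

Definition right_invertible : Prop :=
  exists s : seq R[i], forall z, z \notin s -> \rank (rosenbrock_at z) = (n + p)%N.

Definition stabilisable : Prop :=
  exists F : 'M[R]_(m, n), asymptotically_stable (A + B *m F).

Definition steady_frequency : R[i] :=
  match tm with ContinuousTime => 0 | DiscreteTime => 1 end.

Definition assumption1 : Prop :=
  [/\ right_invertible, stabilisable & ~ invariant_zero steady_frequency].

Definition assumption2 : Prop :=
  exists2 E, is_smith_form rosenbrock_poly E &
    forall z, invariant_zero z -> Cg z ->
      mup z (map_poly (real_complex R) (nonzero_prod E)) = 1%N.

Definition stably_output_nulling (V : {vspace 'cV[R]_n}) : Prop :=
  exists F : 'M[R]_(m, n),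
    [/\ forall v, v \in V -> (A + B *m F) *m v \in V,
        forall v, v \in V -> (C + D *m F) *m v = 0
      & spectrum_in_Cg (restriction (A + B *m F) V)].

Definition is_Vstarg (V : {vspace 'cV[R]_n}) : Prop :=
  stably_output_nulling V /\
  forall W : {vspace 'cV[R]_n}, stably_output_nulling W -> (W <= V)%VS.

(* Projection on the state coordinates of the kernel of the Rosenbrock matrix
   of the system without its [j]-th output; see [mem_Rstar]. *)
Definition Rstar (j : 'I_p) (mu : R) : {vspace 'cV[R]_n} :=
  (linfun usubmx @:
     lker (linfun (mulmx (rosenbrock A B (row' j C) (row' j D) mu)
                   : 'cV[R]_(n + m) -> _)))%VS.

Lemma mem_Rstar (j : 'I_p) (mu : R) (v : 'cV[R]_n) :
  v \in Rstar j mu <->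
  exists w : 'cV[R]_m,
    (A - mu%:M) *m v + B *m w = 0 /\ row' j C *m v + row' j D *m w = 0.
Proof.
split.
- case/memv_imgP => z; rewrite memv_ker lfunE /= => /eqP kz ->.
  rewrite lfunE /=; exists (dsubmx z).
  move: kz; rewrite -{1}[z]vsubmxK mul_block_col => /eqP.
  by rewrite col_mx_eq0 => /andP[/eqP -> /eqP ->].
- case=> w [e1 e2]; apply/memv_imgP; exists (col_mx v w).
    by rewrite memv_ker lfunE /= mul_block_col e1 e2 col_mx0.
  by rewrite lfunE /= col_mxKu.
Qed.

Definition steady_state (r : 'cV[R]_p) (xss : 'cV[R]_n) (uss : 'cV[R]_m) : Prop :=
  match tm with
  | ContinuousTime => A *m xss + B *m uss = 0
  | DiscreteTime => A *m xss + B *m uss = xss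
  end /\ C *m xss + D *m uss = r.

(* Solutions on [0, +oo[ only: the values of [x] and [u] at negative times are
   irrelevant.  The derivative is taken componentwise. *)
Definition ct_trajectory (x : R -> 'cV[R]_n) (u : R -> 'cV[R]_m) : Prop :=
  forall i : 'I_n,
    {within `[0, +oo[, continuous (fun t : R => x t i 0)} /\
    forall t : R, 0 < t ->
      is_derive t 1 (fun s : R => x s i 0) ((A *m x t + B *m u t) i 0).

Definition dt_trajectory (x : nat -> 'cV[R]_n) (u : nat -> 'cV[R]_m) : Prop :=
  forall t, x t.+1 = A *m x t + B *m u t.

(* In both clauses [beta] is chosen before the reference, the steady state and
   the trajectory: it sees only the initial value of [xi = x - xss]. *)
Definition ct_tracking (lam : 'I_p -> R) (F : 'M[R]_(m, n)) : Prop :=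
  exists beta : 'cV[R]_n -> 'I_p -> R,
    forall r xss uss, steady_state r xss uss ->
    forall (x : R -> 'cV[R]_n) (u : R -> 'cV[R]_m) (y : R -> 'cV[R]_p),
      ct_trajectory x u ->
      (forall t, 0 <= t -> u t = F *m (x t - xss) + uss) ->
      (forall t, 0 <= t -> y t = C *m x t + D *m u t) ->
      forall t, 0 <= t -> forall k,
        (y t - r) k 0 = beta (x 0 - xss) k * expR (lam k * t).

Definition dt_tracking (lam : 'I_p -> R) (F : 'M[R]_(m, n)) : Prop :=
  exists beta : 'cV[R]_n -> 'I_p -> R,
    forall r xss uss, steady_state r xss uss ->
    forall (x : nat -> 'cV[R]_n) (u : nat -> 'cV[R]_m) (y : nat -> 'cV[R]_p),
      dt_trajectory x u ->
      (forall t, u t = F *m (x t - xss) + uss) ->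
      (forall t, y t = C *m x t + D *m u t) ->
      forall t k, (y t - r) k 0 = beta (x 0%N - xss) k * lam k ^+ t.

Definition problem3_solvable (lam : 'I_p -> R) : Prop :=
  exists F : 'M[R]_(m, n),
    asymptotically_stable (A + B *m F) /\
    match tm with
    | ContinuousTime => ct_tracking lam F
    | DiscreteTime => dt_tracking lam F
    end.

End System.

(* Main.v *)
Require Import Defs.
From HB Require Import structures.
From mathcomp Require Import all_boot all_order all_algebra.
From mathcomp Require Import all_classical all_reals all_analysis.
From mathcomp Require Import complex.
From mathcomp Require Import zify ring.
Import Order.TTheory GRing.Theory Num.Theory.
Import numFieldNormedType.Exports.
Local Open Scope ring_scope.

Set Implicit Arguments.
Unset Strict Implicit.
Unset Printing Implicit Defensive.

(** Write [M = A + B F] and [E = C + D F] for a feedback [F], and let [L] be the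
    diagonal matrix of the rates [lam].  The tracking error follows [E exp (t M)]
    (or [E M ^ t]), so [F] makes the [k]-th error a multiple of the [k]-th scalar
    mode, for every initial state, exactly when [E M = L E]
    ([ct_tracking_modes], [dt_tracking_modes]).  What remains is algebra: there
    must be an [F] with [M] stable and [E M = L E].

    Sufficiency.  The rank condition is Rado's condition for the subspaces
    [Rstar j (lam j)] modulo [Vg], so vectors [v j] of these subspaces can be
    chosen that together with [Vg] span the state space ([rado_subspaces]).  Let
    [F] agree with a friend of [Vg] on [Vg] and send each [v j] to the input that
    witnesses its membership.  Then [E] kills [Vg], and [v j] is an eigenvector of
    [M] for [lam j] seen by the [j]-th output only, which gives [E M = L E] and
    stability ([modes_feedback]).

    Necessity.  The kernel of [E] is [M]-invariant, stable and output nulling, so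
    it lies in [Vg]; comparing dimensions, it equals [Vg] and [E] is onto
    ([error_kernel_Vstarg]).  It then suffices to find in each
    [Rstar j (lam j)] a vector that [E] maps to the [j]-th unit vector
    ([exists_decoupled_mode], [error_modes_dim]).  An eigenvector of [M] would do,
    but none need exist when [lam j] is also an eigenvalue of [M] on [Vg].
    Instead the controllability inside [Vg] is used: the pair formed by [M] on
    [Vg] and the inputs that stay in [Vg] without feedthrough is controllable at
    [lam j], because [lam j] is not an invariant zero.  This is a dimension count
    ([kernel_pencil_surj]) that rests on there being at least an
    [(m - p)]-dimensional space of such inputs, found at a stable frequency away
    from the spectrum of [M], where the maximality of [Vg] captures every
    output-nulling mode ([nulling_mode_Vstarg]). *)

(** * Rado's theorem for subspaces *)

Section Rado.
Variables (K : fieldType) (vT : vectType K) (I : finType) (V0 : {vspace vT}).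
Implicit Types (U : I -> {vspace vT}) (S : {set I}).

Definition rado_condition U : bool :=
  [forall S : {set I}, (\dim V0 + #|S| <= \dim (V0 + \sum_(j in S) U j)%VS)%N].

Definition replace_at U j H : I -> {vspace vT} :=
  fun i => if i == j then H else U i.

(** If both replacements failed, at index sets containing [j] that are
    [j |: S1] and [j |: S2], then the two deficient sums would have a join
    containing the sum over [j |: (S1 :|: S2)] and a meet containing the sum over
    [S1 :&: S2]; the modular law for dimensions contradicts the condition at
    these two index sets. *)
Lemma rado_condition_split U j H1 H2 :
  (U j <= H1 + H2)%VS -> rado_condition U ->
  rado_condition (replace_at U j H1) \/
  rado_condition (replace_at U j H2).
Proof.
move=> UjE /forallP radoU.
have shrunk H : ~~ rado_condition (replace_at U j H) ->
    exists2 S : {set I}, j \notin S &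
      (\dim (V0 + (H + \sum_(i in S) U i))%VS <= \dim V0 + #|S|)%N.
  rewrite negb_forall => /existsP[S]; rewrite -ltnNge => dimS.
  have jS : j \in S.
    apply: contraLR dimS => jS; rewrite -leqNgt.
    rewrite (eq_bigr U) ?radoU // => i iS; rewrite /replace_at.
    by case: eqP iS jS => // -> ->.
  exists (S :\ j); first by rewrite !inE eqxx.
  move: dimS; rewrite (big_setD1 j jS) /= /replace_at eqxx (cardsD1 j S) jS.
  rewrite (eq_bigr U); first by rewrite addnS addnC.
  by move=> i; rewrite !inE => /andP[/negPf->].
case: (boolP (rado_condition (replace_at U j H1))) => [|/shrunk].
  by left.
case=> S1 jS1 dim1; right; apply: contraT => /shrunk[S2 jS2 dim2].
pose sumU S := (\sum_(i in S) U i)%VS.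
have sumUS S S' : S \subset S' -> (sumU S <= sumU S')%VS.
  by move/fintype.subsetP=> sub; apply/subv_sumP => i iS; apply: (sumv_sup i) => //; apply: sub.
set X := (V0 + _)%VS in dim1; set Y := (V0 + _)%VS in dim2.
have join : (V0 + sumU (j |: (S1 :|: S2)) <= X + Y)%VS.
  rewrite subv_add; apply/andP; split; first by rewrite !addvA -!addvA addvSl.
  apply/subv_sumP => i; rewrite !inE => /or3P[/eqP->|iS|iS].
  - apply: subv_trans UjE _; apply: addvS.
      by apply: subv_trans (addvSr _ _); apply: addvSl.
    by apply: subv_trans (addvSr _ _); apply: addvSl.
  - apply: subv_trans (addvSl _ _); apply: subv_trans (addvSr _ _).
    by apply: subv_trans (addvSr _ _); apply: (sumv_sup i).
  - apply: subv_trans (addvSr _ _); apply: subv_trans (addvSr _ _).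
    by apply: subv_trans (addvSr _ _); apply: (sumv_sup i).
have meet : (V0 + sumU (S1 :&: S2)%SET <= X :&: Y)%VS.
  rewrite subv_cap; apply/andP; split; apply: addvS => //.
    by apply: subv_trans (addvSr _ _); apply: sumUS; apply: finset.subsetIl.
  by apply: subv_trans (addvSr _ _); apply: sumUS; apply: finset.subsetIr.
have := dimv_sum_cap X Y; have := dimvS join; have := dimvS meet.
have := radoU (j |: (S1 :|: S2)); have := radoU (S1 :&: S2).
rewrite cardsU1 !inE negb_or jS1 jS2 /= -/(sumU _) -/(sumU _).
have := cardsUI S1 S2.
lia.
Qed.

(** Rado's theorem for subspaces, relative to [V0]: as long as some [U j] has
    dimension at least two it is the sum of a line and a complement, and one of
    these can take its place; once all [U j] have dimension at most one, the
    condition at the full index set is the conclusion. *)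
Lemma rado_subspaces U :
  rado_condition U ->
  exists2 v : I -> vT, forall j, v j \in U j &
    (\dim V0 + #|I| <= \dim (V0 + \sum_j <[v j]>)%VS)%N.
Proof.
have [N] := ubnP (\sum_j \dim (U j))%N; elim: N U => // N IHN U leN radoU.
case: (boolP [exists j, (1 < \dim (U j))%N]) => [/existsP[j dimj]|].
  pose H1 := <[vpick (U j)]>%VS; pose H2 := (U j :\: H1)%VS.
  have dimH1 : \dim H1 = 1%N.
    rewrite dim_vline vpick0; case: eqP dimj => // ->; by rewrite dimv0.
  have H1U : (H1 <= U j)%VS by rewrite -memvE memv_pick.
  have dimH2 : (\dim H1 + \dim H2)%N = \dim (U j).
    by rewrite -(dimv_cap_compl (U j) H1); move/capv_idPr: H1U => ->.
  have step H : (H <= U j)%VS -> (\dim H < \dim (U j))%N ->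
      rado_condition (replace_at U j H) ->
      exists2 v : I -> vT, forall j, v j \in U j &
        (\dim V0 + #|I| <= \dim (V0 + \sum_j <[v j]>)%VS)%N.
    move=> HU dimH radoH; case: (IHN _ _ radoH) => [|v vH dimv].
      rewrite (bigD1 j) //= /replace_at eqxx; move: leN; rewrite (bigD1 j) //=.
      rewrite ltnS => leN; apply: leq_trans leN.
      rewrite [X in (_ + X < _)%N](eq_bigr (fun i => \dim (U i))).
        by rewrite ltn_add2r.
      by move=> i /negPf /= ->.
    exists v => // i; move: (vH i); rewrite /replace_at; case: eqP => // -> .
    exact: subvP HU _.
  case: (@rado_condition_split U j H1 H2 _ radoU) => [|radoH|radoH].
  - by rewrite addvC addv_diff addvSl.
  - by apply: step radoH; rewrite ?dimH1.
  - by apply: step radoH; [exact: diffvSl|rewrite -dimH2 dimH1].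
rewrite negb_exists => /forallP dim1.
exists (fun j => vpick (U j)) => [j|]; first exact: memv_pick.
have lineE j : <[vpick (U j)]>%VS = U j.
  apply/eqP; rewrite eqEdim -memvE memv_pick /= dim_vline vpick0.
  case: eqP => [->|_]; first by rewrite dimv0.
  by move: (dim1 j); rewrite -leqNgt.
rewrite (eq_bigr U) => [|j _]; last exact: lineE.
have := forallP radoU [set: I]%SET; rewrite cardsT.
by congr (_ <= \dim (_ + _)%VS)%N; apply: eq_bigl => j; rewrite inE.
Qed.
End Rado.

(** * Kernels, bases and selections for column vectors *)

Section ColumnSpaces.
Variable K : fieldType.

Definition col_ker (a b : nat) (Q : 'M[K]_(a, b)) : {vspace 'cV[K]_b} :=
  lker (linfun (mulmx Q : 'cV_b -> 'cV_a)).

Lemma mem_col_ker a b (Q : 'M[K]_(a, b)) v : (v \in col_ker Q) = (Q *m v == 0).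
Proof. by rewrite memv_ker lfunE. Qed.

Lemma dim_cV a : dim 'cV[K]_a = a.
Proof. by rewrite /dim /= muln1. Qed.

Lemma leq_dim_col_ker a b (Q : 'M[K]_(a, b)) : (b <= \dim (col_ker Q) + a)%N.
Proof.
have := limg_ker_dim (linfun (mulmx Q : 'cV_b -> 'cV_a)) fullv.
rewrite capfv -/(col_ker Q) dimvf dim_cV => {1}<-; rewrite leq_add2l.
have := dimvS (subvf (linfun (mulmx Q : 'cV_b -> 'cV_a) @: fullv)).
by rewrite dimvf dim_cV.
Qed.

Lemma dim_col_ker_row_free a b (Q : 'M[K]_(a, b)) :
  row_free Q -> (\dim (col_ker Q) + a)%N = b.
Proof.
case/row_freeP=> G QG; set f := linfun (mulmx Q : 'cV_b -> 'cV_a).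
have imf : \dim (f @: fullv)%VS = a.
  rewrite -[RHS]dim_cV -dimvf; congr (\dim _); apply/eqP.
  rewrite eqEsubv subvf; apply/subvP => w _.
  apply/memv_imgP; exists (G *m w); first exact: memvf.
  by rewrite lfunE /= mulmxA QG mul1mx.
by have := limg_ker_dim f fullv; rewrite imf capfv dimvf dim_cV.
Qed.

Lemma col_ker_surj a b (Q : 'M[K]_(a, b)) :
  (\dim (col_ker Q) + a = b)%N -> forall w : 'cV_a, exists v, Q *m v = w.
Proof.
move=> dimQ w; set f := linfun (mulmx Q : 'cV_b -> 'cV_a).
have /memv_imgP[v _ ->] : w \in (f @: fullv)%VS; last by exists v; rewrite lfunE.
suff -> : (f @: fullv = fullv)%VS by exact: memvf.
apply/eqP; rewrite eqEdim subvf /= dimvf dim_cV -(leq_add2l (\dim (col_ker Q))).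
by rewrite dimQ; have := limg_ker_dim f fullv; rewrite capfv dimvf dim_cV => ->.
Qed.

Definition basis_mx n (V : {vspace 'cV[K]_n}) : 'M[K]_(n, \dim V) :=
  \matrix_(i, j) (vbasis V)`_j i 0.

Lemma mulmx_basis n (V : {vspace 'cV[K]_n}) (c : 'cV_(\dim V)) :
  basis_mx V *m c = \sum_j c j 0 *: (vbasis V)`_j.
Proof.
apply/colP => i; rewrite !mxE summxE; apply: eq_bigr => j _.
by rewrite !mxE mulrC.
Qed.

Lemma mem_basis_mx n (V : {vspace 'cV[K]_n}) c : basis_mx V *m c \in V.
Proof.
rewrite mulmx_basis; apply: memv_suml => j _; apply: memvZ.
by apply: vbasis_mem; rewrite mem_nth // size_tuple.
Qed.

Lemma basis_mx_coord n (V : {vspace 'cV[K]_n}) v :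
  v \in V -> v = basis_mx V *m \col_i coord (vbasis V) i v.
Proof.
by move=> /coord_vbasis {1}->; rewrite mulmx_basis; apply: eq_bigr => i _; rewrite mxE.
Qed.

Lemma basis_mx_inj n (V : {vspace 'cV[K]_n}) : exists Y, Y *m basis_mx V = 1%:M.
Proof.
exists (\matrix_(i, j) coord (vbasis V) i (delta_mx j 0)).
apply/matrixP => i j; rewrite !mxE.
rewrite eq_sym -(coord_free j i (basis_free (vbasisP V))).
have -> : (vbasis V)`_j = \sum_l (vbasis V)`_j l 0 *: delta_mx l 0.
  by rewrite [LHS]matrix_sum_delta; apply: eq_bigr => l _; rewrite big_ord1.
rewrite linear_sum; apply: eq_bigr => l _.
by rewrite linearZ /= !mxE mulrC.
Qed.

Lemma restrictionP n (M : 'M[K]_n) (V : {vspace 'cV[K]_n}) :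
  (forall v, v \in V -> M *m v \in V) ->
  M *m basis_mx V = basis_mx V *m restriction M V.
Proof.
move=> MV; apply/matrixP => i j.
have -> : (M *m basis_mx V) i j = (M *m (vbasis V)`_j) i 0.
  by rewrite !mxE; apply: eq_bigr => l _; rewrite !mxE.
have /basis_mx_coord {1}-> : M *m (vbasis V)`_j \in V.
  by apply: MV; apply: vbasis_mem; rewrite mem_nth // size_tuple.
by rewrite !mxE; apply: eq_bigr => l _; rewrite !mxE.
Qed.

(** A vectorwise choice made on a basis extends linearly; with
    [Q1 = A - s I] stacked on [C] and [Q2 = B] stacked on [D] this produces
    feedback matrices. *)
Lemma linear_selection a n m (Q1 : 'M[K]_(a, n)) (Q2 : 'M[K]_(a, m))
    (V : {vspace 'cV[K]_n}) :
  (forall v, v \in V -> exists w, Q1 *m v + Q2 *m w = 0) ->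
  exists F : 'M[K]_(m, n), forall v, v \in V -> Q1 *m v + Q2 *m (F *m v) = 0.
Proof.
move=> sel.
have /fin_all_exists[w wP] (j : 'I_(\dim V)) : exists w,
    Q1 *m col j (basis_mx V) + Q2 *m w = 0.
  by apply: sel; rewrite colE; apply: mem_basis_mx.
have [Y YV] := basis_mx_inj V.
pose W := \matrix_(i, j) w j i 0.
have WE j : w j = col j W by apply/colP => i; rewrite !mxE.
have QW : Q1 *m basis_mx V + Q2 *m W = 0.
  apply/matrixP => i j; have := congr1 (fun z : 'cV_a => z i 0) (wP j).
  by rewrite WE !colE !mulmxA -mulmxDl -colE [LHS]mxE => ->; rewrite !mxE.
exists (W *m Y) => v /basis_mx_coord ->; set c := \col__ _.
by rewrite !mulmxA -(mulmxA _ Y) YV mulmx1 -mulmxDl QW mul0mx.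
Qed.

(** [eigenvalue] is defined by left eigenvectors; restriction to a subspace of
    columns needs right ones. *)
Lemma eigenvalue_colP n (M : 'M[K]_n) a :
  reflect (exists2 c : 'cV_n, M *m c = a *: c & c != 0) (eigenvalue M a).
Proof.
rewrite /eigenvalue /eigenspace kermx_eq0 -row_leq_rank -mxrank_tr row_leq_rank.
rewrite -kermx_eq0; apply: (iffP idP) => [|[c Mc c0]].
  case/rowV0Pn => v /sub_kermxP vM v0; exists v^T; last by rewrite trmx_eq0.
  have := congr1 trmx vM; rewrite trmx_mul trmxK trmx0 mulmxBl mul_scalar_mx.
  by move/eqP; rewrite subr_eq0 => /eqP.
apply/rowV0Pn; exists c^T; last by rewrite trmx_eq0.
by apply/sub_kermxP; rewrite -trmx_mul mulmxBl Mc mul_scalar_mx subrr trmx0.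
Qed.

End ColumnSpaces.

(** * Stable frequencies and restrictions *)

Lemma avoid_seq (T : eqType) (f : nat -> T) (l : seq T) :
  injective f -> exists k, f k \notin l.
Proof.
move=> injf; apply: contrapT => no.
have : (size [seq f k | k <- iota 0 (size l).+1] <= size l)%N.
  apply: uniq_leq_size; first by rewrite map_inj_uniq // iota_uniq.
  move=> _ /mapP[k _ ->]; apply: contrapT => /negP kl; apply: no; by exists k.
by rewrite size_map size_iota ltnn.
Qed.

Section Stability.
Variables (R : realType) (tm : time_domain).
Local Notation rc := (real_complex R).

Lemma Lambdag_Cg l : Lambdag tm l -> Cg tm (rc l).
Proof.
case: tm => //= /andP[l0 l1].
by rewrite normc_def /= expr0n addr0 sqrtr_sqr ger0_norm // (ltcR l 1).
Qed.

Lemma Lambdag_avoid (l : seq R[i]) : exists2 s, Lambdag tm s & rc s \notin l.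
Proof.
case: tm => /=.
- have inj : injective (fun k => rc (- k.+1%:R)).
    by move=> i j /complexI /oppr_inj /eqP; rewrite eqr_nat => /eqP [].
  have [k kl] := avoid_seq l inj.
  by exists (- k.+1%:R) => //; rewrite oppr_lt0 ltr0n.
- have inj : injective (fun k => rc k.+2%:R^-1).
    by move=> i j /complexI /invr_inj /eqP; rewrite eqr_nat => /eqP [].
  have [k kl] := avoid_seq l inj.
  by exists k.+2%:R^-1 => //; rewrite invr_ge0 ler0n invf_lt1 ?ltr1n ?ltr0n.
Qed.

Lemma eigenvalue_seq n (M : 'M[R[i]]_n) :
  exists l : seq R[i], forall z, eigenvalue M z -> z \in l.
Proof.
have [l charE] := closed_field_poly_normal (char_poly M).
exists l => z; rewrite eigenvalue_root_char charE.
have /monicP -> := char_poly_monic M.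
by rewrite scale1r root_prod_XsubC.
Qed.

(** A right eigenvector of the restriction, read in the basis of [V], is one of
    the whole matrix. *)
Lemma restriction_stable n (M : 'M[R]_n) (V : {vspace 'cV_n}) :
  (forall v, v \in V -> M *m v \in V) ->
  spectrum_in_Cg tm M -> spectrum_in_Cg tm (restriction M V).
Proof.
move=> MV stM z /eigenvalue_colP[c Nc c0]; apply: stM; apply/eigenvalue_colP.
have [Y YV] := basis_mx_inj V.
exists (cplx (basis_mx V) *m c).
  by rewrite mulmxA -map_mxM restrictionP // map_mxM -mulmxA Nc -scalemxAr.
apply: contra_neq c0 => Vc; have := congr1 (mulmx (cplx Y)) Vc.
by rewrite mulmxA -map_mxM YV map_mx1 mul1mx mulmx0.
Qed.

Lemma restriction_scalar n (M : 'M[R]_n) (V : {vspace 'cV_n}) s :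
  (forall v, v \in V -> M *m v = s *: v) -> restriction M V = s%:M.
Proof.
move=> MV; have [Y YV] := basis_mx_inj V.
have inv v : v \in V -> M *m v \in V by move=> vV; rewrite MV // memvZ.
rewrite -[LHS]mul1mx -YV -mulmxA -restrictionP //.
suff -> : M *m basis_mx V = s *: basis_mx V by rewrite -scalemxAr YV scalemx1.
apply/trmx_inj/row_matrixP => j; rewrite -!tr_col; congr (_^T).
by rewrite !colE -mulmxA MV ?mem_basis_mx // scalemxAl.
Qed.

Lemma real_noneigenvalue_unit n (M : 'M[R]_n) s :
  ~~ eigenvalue (cplx M) (rc s) -> M - s%:M \in unitmx.
Proof.
rewrite /eigenvalue /eigenspace negbK kermx_eq0 /cplx -map_scalar_mx -map_mxB.
by rewrite row_free_map row_free_unit.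
Qed.

End Stability.

(** * Rank of the Rosenbrock matrix *)

Section Rosenbrock.
Variables (R : realType) (n m p : nat) (S : lti_system R n m p).
Local Notation rc := (real_complex R).
Local Notation A := (sysA S).
Local Notation B := (sysB S).
Local Notation C := (sysC S).
Local Notation D := (sysD S).

Lemma rosenbrock_at_real s :
  rosenbrock_at S (rc s) = map_mx rc (rosenbrock A B C D s).
Proof. by rewrite /rosenbrock map_block_mx map_mxB map_scalar_mx. Qed.

Lemma map_horner_polyC s a b (Q : 'M[R]_(a, b)) :
  map_mx (horner_eval s) (map_mx polyC Q) = Q.
Proof. by apply/matrixP => i j; rewrite !mxE /horner_eval hornerC. Qed.

Lemma rosenbrock_poly_eval s :
  map_mx (horner_eval s) (rosenbrock_poly S) = rosenbrock A B C D s.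
Proof.
rewrite /rosenbrock map_block_mx map_mxB map_scalar_mx !map_horner_polyC /=.
by rewrite /horner_eval hornerX.
Qed.

(** A right inverse [G] of the Rosenbrock matrix at one real point [s] is a
    constant matrix; multiplied by it, the polynomial Rosenbrock matrix has a
    determinant that is [1] at [s], hence is nonzero. *)
Lemma right_invertible_normal_rank : right_invertible S -> normal_rank S = (n + p)%N.
Proof.
case=> l full; have [s _ sl] := Lambdag_avoid ContinuousTime l.
have /row_freeP[G PG] : row_free (rosenbrock A B C D s).
  by rewrite /row_free -(mxrank_map rc) -rosenbrock_at_real full.
apply/eqP; rewrite -/(row_free _) -row_leq_rank.
pose Q := rosenbrock_poly S *m map_mx polyC G.
have evQ : map_mx (horner_eval s) Q = 1%:M.
  by rewrite map_mxM rosenbrock_poly_eval map_horner_polyC.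
have detQ : \det Q != 0.
  apply: contra_eq_neq (congr1 determinant evQ) => Q0.
  by rewrite det_map_mx Q0 rmorph0 det1 eq_sym oner_eq0.
have : map_mx (@tofrac {poly R}) Q \in unitmx.
  by rewrite unitmxE det_map_mx unitfE tofrac_eq0.
rewrite map_mxM -row_full_unit => /eqP {1}<-; exact: mxrankM_maxl.
Qed.

Lemma rosenbrock_row_free s :
  right_invertible S -> ~ invariant_zero S (rc s) ->
  row_free (rosenbrock A B C D s).
Proof.
move=> /right_invertible_normal_rank nrk /negP; rewrite -leqNgt nrk.
by rewrite rosenbrock_at_real mxrank_map row_leq_rank.
Qed.

(** State feedback multiplies the Rosenbrock matrix on the right by an
    invertible matrix. *)
Lemma rosenbrock_feedback s F :
  row_free (rosenbrock A B C D s) ->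
  row_free (rosenbrock (A + B *m F) B (C + D *m F) D s).
Proof.
case/row_freeP=> G PG; apply/row_freeP.
exists (block_mx 1%:M 0 (- F) 1%:M *m G); rewrite mulmxA -[RHS]PG; congr (_ *m _).
rewrite mulmx_block !mulmx1 !mulmx0 !add0r !mulmxN.
by rewrite addrAC addrK addrK.
Qed.

End Rosenbrock.

(** * Decoupling: what a solution forces *)

(** Let [Q] be the space of the pairs [(x, u)] with [E x = 0] and [T u = 0].
    The map [(x, u) |-> (M - l) x + B u] sends [Q] into the kernel of [E], and it
    vanishes only on kernel vectors of the Rosenbrock matrix at [l], which form a
    space of dimension [m - p].  As [Q] has dimension at least [(n - p) + (m - p)],
    the image has dimension at least [n - p], so it is the whole kernel of [E].
    The count uses that [T] has [p] rows: the two conditions on [u] stacked would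
    have [2 p] rows and give a bound too weak by [p]. *)
Lemma kernel_pencil_surj (K : fieldType) (n m p : nat) (M : 'M[K]_n)
    (B : 'M[K]_(n, m)) (E : 'M[K]_(p, n)) (D T : 'M[K]_(p, m)) l :
  (\dim (col_ker E) + p = n)%N ->
  row_free (rosenbrock M B E D l) ->
  (forall x : 'cV_n, E *m x = 0 -> E *m (M *m x) = 0) ->
  (forall u : 'cV_m, T *m u = 0 -> D *m u = 0 /\ E *m (B *m u) = 0) ->
  forall g : 'cV_n, E *m g = 0 -> exists (x : 'cV_n) (u : 'cV_m),
    [/\ E *m x = 0, D *m u = 0 & (M - l%:M) *m x + B *m u = g].
Proof.
move=> dimE freeP invE TP g Eg.
pose Q := col_ker (block_mx E 0 0 T).
pose psi := linfun (mulmx (row_mx (M - l%:M) B) : 'cV_(n + m) -> 'cV_n).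
have QP z : z \in Q -> E *m usubmx z = 0 /\ T *m dsubmx z = 0.
  rewrite mem_col_ker -{1}[z]vsubmxK mul_block_col !mul0mx addr0 add0r col_mx_eq0.
  by case/andP => /eqP-> /eqP->.
have sub1 : (psi @: Q <= col_ker E)%VS.
  apply/subvP => _ /memv_imgP[z /QP[Ex Tu] ->]; rewrite mem_col_ker lfunE /=.
  rewrite -{1}[z]vsubmxK mul_row_col mulmxDr; have [_ ->] := TP _ Tu.
  by rewrite mulmxBl mulmxBr invE // mul_scalar_mx -scalemxAr Ex scaler0 subr0 addr0.
have sub2 : (Q :&: lker psi <= col_ker (rosenbrock M B E D l))%VS.
  apply/subvP => z; rewrite memv_cap => /andP[/QP[Ex Tu]].
  rewrite memv_ker lfunE /= mem_col_ker -{1 2}[z]vsubmxK.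
  rewrite mul_row_col mul_block_col Ex => /eqP->.
  by have [-> _] := TP _ Tu; rewrite addr0 col_mx0.
have psiQ : (psi @: Q = col_ker E)%VS.
  apply/eqP; rewrite eqEdim sub1 /=.
  have := limg_ker_dim psi Q; have := dimvS sub2.
  have := dim_col_ker_row_free freeP; have := leq_dim_col_ker (block_mx E 0 0 T).
  rewrite -/Q; move: dimE.
  move: (\dim (Q :&: _)) (\dim (psi @: Q)) (\dim Q) (\dim (col_ker E)) => a b c d.
  move: (\dim _) => e; lia.
have : g \in col_ker E by rewrite mem_col_ker Eg.
rewrite -psiQ => /memv_imgP[z /QP[Ex Tu] ->].
exists (usubmx z), (dsubmx z); split=> //; first by case: (TP _ Tu).
by rewrite lfunE /= -mul_row_col vsubmxK.
Qed.

Section Decoupling.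
Variables (R : realType) (n m p : nat) (tm : time_domain) (S : lti_system R n m p).
Local Notation rc := (real_complex R).
Local Notation A := (sysA S).
Local Notation B := (sysB S).
Local Notation C := (sysC S).
Local Notation D := (sysD S).

(** With [E = C + D F], [M = A + B F] and [L = diag lam] this is [E M = L E]: each
    output error is, along every closed loop trajectory, a scalar mode of rate
    [lam k]. *)
Definition error_modes (lam : 'I_p -> R) (F : 'M[R]_(m, n)) : Prop :=
  (C + D *m F) *m (A + B *m F) =
  diag_mx (\row_j lam j) *m (C + D *m F).

(** A feedback with [F x = u] makes the line of [x] invariant, with eigenvalue
    [s], and invisible at the output; [Vg] contains every such line. *)
Lemma nulling_mode_Vstarg Vg s x u :
  is_Vstarg tm S Vg -> Lambdag tm s ->
  (A - s%:M) *m x + B *m u = 0 -> C *m x + D *m u = 0 -> x \in Vg.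
Proof.
move=> [_ maxVg] Ls Ax Cx.
have [F FP] : exists F : 'M[R]_(m, n), forall v, v \in <[x]>%VS ->
    col_mx (A - s%:M) C *m v + col_mx B D *m (F *m v) = 0.
  apply: linear_selection => _ /vlineP[k ->]; exists (k *: u).
  by rewrite -!scalemxAr -scalerDr !mul_col_mx add_col_mx Ax Cx col_mx0 scaler0.
have modeF v : v \in <[x]>%VS ->
    (A + B *m F) *m v = s *: v /\ (C + D *m F) *m v = 0.
  move=> /FP/eqP; rewrite !mul_col_mx add_col_mx col_mx_eq0 => /andP[/eqP Av /eqP Cv].
  split; last by rewrite mulmxDl -mulmxA.
  apply/eqP; rewrite -subr_eq0 -[X in _ == X]Av mulmxBl mul_scalar_mx mulmxDl mulmxA.
  by rewrite addrAC.
rewrite memvE; apply: maxVg; exists F; split.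
- by move=> v xv; case: (modeF v xv) => -> _; apply: memvZ.
- by move=> v /modeF[].
- rewrite (@restriction_scalar _ _ _ _ s) => [z|v /modeF[] //].
  case/eigenvalue_colP=> c; rewrite /cplx map_scalar_mx mul_scalar_mx => /eqP.
  rewrite -subr_eq0 -scalerBl scaler_eq0 => /orP[|/eqP->]; last by rewrite eqxx.
  by rewrite subr_eq0 => /eqP <- _; apply: Lambdag_Cg.
Qed.

(** The kernel of [C + D F] is invariant under the stable matrix [A + B F] and
    output nulling, so it lies in [Vg]; it has codimension at most [p], which is
    the codimension of [Vg]. *)
Lemma error_kernel_Vstarg lam F Vg :
  is_Vstarg tm S Vg -> (\dim Vg + p = n)%N ->
  asymptotically_stable tm (A + B *m F) -> error_modes lam F ->
  col_ker (C + D *m F) = Vg.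
Proof.
move=> [_ maxVg] dimVg stM EM; set E := C + D *m F in EM *.
apply/eqP; rewrite eqEdim; apply/andP; split; last first.
  by have := leq_dim_col_ker E; rewrite -{1}dimVg leq_add2r.
have inv v : v \in col_ker E -> (A + B *m F) *m v \in col_ker E.
  rewrite !mem_col_ker => /eqP Ev.
  by rewrite mulmxA /E EM -/E -mulmxA Ev mulmx0.
apply: maxVg; exists F; split=> //.
- by move=> v; rewrite mem_col_ker => /eqP.
- exact: restriction_stable.
Qed.

(** A preimage [v0] of the [j]-th unit vector under [E = C + D F] satisfies
    [E (M - lam j) v0 = 0], where [M = A + B F].  Correcting it by an [x] in the
    kernel of [E], with a suitable input, makes it a mode of rate [lam j].  The
    correction exists even when [lam j] is an eigenvalue of [M] on the kernel of
    [E]: since [lam j] is not a zero, [kernel_pencil_surj] applies.  The matrix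
    [T] there is the value of the closed loop transfer matrix at a stable real
    frequency [s] that is not an eigenvalue of [M]; an input killed by [T]
    excites, at frequency [s], an output-nulling mode, which lies in [Vg]. *)
Lemma exists_decoupled_mode lam F Vg j :
  is_Vstarg tm S Vg -> (\dim Vg + p = n)%N -> right_invertible S ->
  ~ invariant_zero S (rc (lam j)) ->
  asymptotically_stable tm (A + B *m F) -> error_modes lam F ->
  exists2 v, v \in Rstar S j (lam j) & (C + D *m F) *m v = delta_mx j 0.
Proof.
move=> VgP dimVg rinv nzj stM EM.
have kerE := error_kernel_Vstarg VgP dimVg stM EM.
have freeP := rosenbrock_feedback F (rosenbrock_row_free rinv nzj).
rewrite /error_modes in EM.
set M := A + B *m F in stM EM freeP; set E := C + D *m F in EM kerE freeP *.
set L := diag_mx _ in EM.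
have dimE : (\dim (col_ker E) + p)%N = n by rewrite kerE.
have invE (x : 'cV_n) : E *m x = 0 -> E *m (M *m x) = 0.
  by move=> Ex; rewrite mulmxA EM -mulmxA Ex mulmx0.
have [l lP] := eigenvalue_seq (cplx M).
have [s Ls sl] := Lambdag_avoid tm l.
have unitM : M - s%:M \in unitmx.
  by apply: real_noneigenvalue_unit; apply: contra sl => /lP.
pose G := - (invmx (M - s%:M) *m B); pose T := D + E *m G.
have GE (u : 'cV_m) : (M - s%:M) *m (G *m u) + B *m u = 0.
  by rewrite mulmxA mulmxN mulKVmx // mulNmx addNr.
have TP (u : 'cV_m) : T *m u = 0 -> D *m u = 0 /\ E *m (B *m u) = 0.
  rewrite mulmxDl -mulmxA => Tu.
  have : G *m u \in Vg.
    apply: (nulling_mode_Vstarg VgP Ls (u := F *m (G *m u) + u)).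
      rewrite mulmxDr addrA -[RHS](GE u); congr (_ + _).
      by rewrite [B *m _]mulmxA -mulmxDl /M addrAC.
    rewrite mulmxDr addrA -[RHS]Tu addrC; congr (_ + _).
    by rewrite mulmxA -mulmxDl.
  rewrite -kerE mem_col_ker => /eqP EG; move: Tu; rewrite EG addr0 => ->; split=> //.
  have := congr1 (mulmx E) (GE u); rewrite mulmx0 mulmxDr.
  by rewrite mulmxBl mulmxBr invE // mul_scalar_mx -scalemxAr EG scaler0 subr0 add0r.
have [v0 Ev0] := col_ker_surj dimE (delta_mx j 0).
have Eg : E *m ((M - (lam j)%:M) *m v0) = 0.
  rewrite mulmxBl mulmxBr mulmxA EM -mulmxA mul_scalar_mx -scalemxAr Ev0.
  apply/eqP; rewrite subr_eq0; apply/eqP/colP => i; rewrite mul_diag_mx !mxE.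
  by case: (eqVneq i j) => [->|_] //; rewrite !mulr0.
have [x [u [Ex Du xu]]] := kernel_pencil_surj dimE freeP invE TP Eg.
exists (v0 - x); last by rewrite mulmxBr Ev0 Ex subr0.
apply/mem_Rstar; exists (F *m (v0 - x) - u).
have -> : (A - (lam j)%:M) *m (v0 - x) + B *m (F *m (v0 - x) - u) =
    (M - (lam j)%:M) *m (v0 - x) - B *m u.
  rewrite [B *m (_ - u)]mulmxBr addrA; congr (_ - _); rewrite [B *m _]mulmxA -mulmxDl /M.
  by rewrite addrAC.
have CE : C *m (v0 - x) + D *m (F *m (v0 - x) - u) = delta_mx j 0.
  rewrite [D *m (_ - u)]mulmxBr addrA Du subr0 mulmxA -mulmxDl -/E mulmxBr Ev0 Ex.
  by rewrite subr0.
split; first by rewrite mulmxBr -xu -addrA -opprD subrr.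
rewrite !row'Esub !mul_rowsub_mx -linearD /= CE; apply/colP => i; rewrite !mxE.
by rewrite [_ == j]eq_sym (negPf (neq_lift _ _)).
Qed.

(** [C + D F] has kernel [Vg] and maps the sum over [J] onto a space containing
    the unit vectors of index in [J]. *)
Lemma error_modes_dim lam F Vg (J : {set 'I_p}) :
  is_Vstarg tm S Vg -> (\dim Vg + p = n)%N -> right_invertible S ->
  (forall j, ~ invariant_zero S (rc (lam j))) ->
  asymptotically_stable tm (A + B *m F) -> error_modes lam F ->
  (n - p + #|J| <= \dim (Vg + \sum_(j in J) Rstar S j (lam j))%VS)%N.
Proof.
move=> VgP dimVg rinv nz stM EM.
have kerE := error_kernel_Vstarg VgP dimVg stM EM.
have modes j := exists_decoupled_mode VgP dimVg rinv (nz j) stM EM.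
set E := C + D *m F in kerE modes.
pose f := linfun (mulmx E : 'cV_n -> 'cV_p).
set U := (Vg + _)%VS.
(* The unit vectors outside [J] complete the image to the whole space. *)
have imU : (fullv <= f @: U + \sum_(j in ~: J) <[delta_mx j 0%R : 'cV[R]_p]>)%VS.
  apply/subvP => w _; rewrite [w]matrix_sum_delta.
  apply: memv_suml => j _; rewrite big_ord1; apply: memvZ.
  case: (boolP (j \in J)) => jJ.
    have [v vR Ev] := modes j; apply: (subvP (addvSl _ _)).
    rewrite -Ev -[E *m v](lfunE (mulmx E : 'cV_n -> 'cV_p)); apply: memv_img.
    by apply: (subvP (addvSr _ _)); apply: (subvP (sumv_sup j jJ (subvv _))).
  apply: (subvP (addvSr _ _)); have jJ' : j \in ~: J by rewrite inE.
  by apply: (subvP (sumv_sup j jJ' (subvv _))); apply: memv_line.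
have kerU : (U :&: lker f = Vg)%VS.
  by rewrite -/(col_ker E) kerE; apply/capv_idPr; apply: addvSl.
have dimline : (\dim (\sum_(j in ~: J) <[delta_mx j 0%R : 'cV[R]_p]>)%VS <= #|~: J|)%N.
  apply: leq_trans (dimv_leq_sum _ _ _) _; rewrite -sum1_card.
  by apply: leq_sum => j _; rewrite dim_vline leq_b1.
have dimU := limg_ker_dim f U; rewrite kerU in dimU.
have := dimvS imU; rewrite dimvf dim_cV => le_p.
have := dimv_sum_cap (f @: U) (\sum_(j in ~: J) <[delta_mx j 0%R : 'cV[R]_p]>)%VS.
have := cardsC J; rewrite card_ord -dimU.
have -> : (n - p)%N = \dim Vg by rewrite -[in LHS]dimVg addnK.
rewrite leq_add2l.
move: le_p dimline.
move: (\dim (f @: U)) (\dim (f @: U + _)) (\dim (f @: U :&: _)) => a b c.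
move: (\dim _) => d; lia.
Qed.
End Decoupling.

(** * Synthesis of the feedback *)

Section Synthesis.
Variables (R : realType) (n m p : nat) (tm : time_domain) (S : lti_system R n m p).
Local Notation rc := (real_complex R).
Local Notation A := (sysA S).
Local Notation B := (sysB S).
Local Notation C := (sysC S).
Local Notation D := (sysD S).

(** The frame is square only up to the equation [dimV], so both one-sided
    inverses have to be produced. *)
Lemma spanning_frame (V : {vspace 'cV[R]_n}) (v : 'I_p -> 'cV[R]_n) :
  (\dim V + p = n)%N -> (n <= \dim (V + \sum_j <[v j]>)%VS)%N ->
  exists Z, row_mx (basis_mx V) (\matrix_(i, j) v j i 0) *m Z = 1%:M /\
            Z *m row_mx (basis_mx V) (\matrix_(i, j) v j i 0) = 1%:M.
Proof.
move=> dimV le_n; set T := row_mx _ _.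
have full : (V + \sum_j <[v j]>)%VS = fullv.
  by apply/eqP; rewrite eqEdim subvf /= dimvf dim_cV.
have T_surj (x : 'cV_n) : exists c : 'cV_(\dim V + p), T *m c = x.
  have : x \in (V + \sum_j <[v j]>)%VS by rewrite full memvf.
  case/memv_addP=> y /basis_mx_coord yV [_ /memv_sumP[w wv ->] ->].
  have /fin_all_exists[a aP] : forall j, exists a, w j = a *: v j.
    by move=> j; apply/vlineP; apply: wv.
  rewrite yV; set c := \col_i _; exists (col_mx c (\col_j a j)).
  rewrite mul_row_col; congr (_ + _).
  apply/colP => i; rewrite mxE summxE; apply: eq_bigr => j _.
  by rewrite aP !mxE mulrC.
have freeT : row_free T.
  rewrite -kermx_eq0; apply/rowV0P => r /sub_kermxP rT.
  apply/rowP => j; have [c Tc] := T_surj (delta_mx j 0).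
  have := congr1 (fun z : 'M[R]_1 => z 0 0) (mulmxA r T c).
  rewrite rT mul0mx Tc !mxE => <-; rewrite (bigD1 j) //= big1 => [|i ij].
    by rewrite mxE !eqxx mulr1 addr0.
  by rewrite !mxE (negPf ij) mulr0.
have /row_freeP[Z TZ] := freeT; exists Z; split=> //.
have /row_freeP[G TG] : row_free T^T.
  by rewrite /row_free mxrank_tr (eqP freeT) dimV.
have GT : G^T *m T = 1%:M by rewrite -[T]trmxK -trmx_mul TG trmx1.
by rewrite -[Z]mul1mx -GT -(mulmxA G^T) TZ mulmx1.
Qed.

(** The feedback agrees with a friend of [Vg] on [Vg] and sends each [v j] to the
    input that makes it a mode of rate [lam j].  A left eigenvector of the closed
    loop that does not vanish at some [v j] has eigenvalue [lam j]; one that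
    vanishes at all of them restricts to a left eigenvector on [Vg]. *)
Lemma modes_feedback lam Vg v :
  stably_output_nulling tm S Vg -> (\dim Vg + p = n)%N ->
  (forall j, Lambdag tm (lam j)) ->
  (forall j, v j \in Rstar S j (lam j)) ->
  (n <= \dim (Vg + \sum_j <[v j]>)%VS)%N ->
  exists F, asymptotically_stable tm (A + B *m F) /\ error_modes S lam F.
Proof.
move=> [Fg [invg nullg stg]] dimVg lamg vR le_n.
have [Z [TZ ZT]] := spanning_frame dimVg le_n.
have /fin_all_exists[w wP] : forall j, exists w : 'cV_m,
    (A - (lam j)%:M) *m v j + B *m w = 0 /\
    row' j C *m v j + row' j D *m w = 0.
  by move=> j; apply/mem_Rstar.
set bV := basis_mx Vg in TZ ZT.
set vM := \matrix_(i, j) v j i 0 in TZ ZT.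
pose wM : 'M[R]_(m, p) := \matrix_(i, j) w j i 0.
have vE j : col j vM = v j by apply/colP => i; rewrite !mxE.
have wE j : col j wM = w j by apply/colP => i; rewrite !mxE.
have [F FT] : exists F, F *m row_mx bV vM = row_mx (Fg *m bV) wM.
  by exists (row_mx (Fg *m bV) wM *m Z); rewrite -mulmxA ZT mulmx1.
move: FT; rewrite mul_mx_row => /eq_row_mx[FbV FvM].
exists F; set M := A + B *m F; set E := C + D *m F.
have MbV : M *m bV = bV *m restriction (A + B *m Fg) Vg.
  by rewrite -restrictionP // /M !mulmxDl -!mulmxA FbV.
have MvM : M *m vM = vM *m diag_mx (\row_j lam j).
  rewrite /M mulmxDl -mulmxA FvM; apply/matrixP => i j.
  have [/(congr1 (fun z : 'cV_n => z i 0)) + _] := wP j.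
  rewrite -vE -wE !colE !mulmxA -mulmxDl -colE mulmxBl mul_scalar_mx addrAC.
  by rewrite mul_mx_diag mxE !mxE [lam j * _]mulrC => /eqP; rewrite subr_eq0 => /eqP.
have EbV : E *m bV = 0.
  rewrite /E mulmxDl -mulmxA FbV mulmxA -mulmxDl.
  apply/trmx_inj/row_matrixP => j; rewrite -tr_col colE -mulmxA nullg ?mem_basis_mx //.
  by rewrite !trmx0 row0.
have EvM (i j : 'I_p) : i != j -> (E *m vM) i j = 0.
  case: (unliftP j i) => [k -> _|-> /eqP //]; have [_] := wP j.
  rewrite /E mulmxDl -mulmxA FvM !row'Esub !mul_rowsub_mx -linearD /=.
  move/(congr1 (fun z : 'M[R]_(_, 1) => z k 0)).
  by rewrite -vE -wE !colE !mulmxA -mulmxDl -colE !mxE.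
split.
- move=> z /eigenvalueP[r rM r0].
  have rvE : r *m cplx vM *m cplx (diag_mx (\row_j lam j)) = z *: (r *m cplx vM).
    by rewrite -mulmxA -map_mxM -MvM map_mxM mulmxA rM scalemxAl.
  case: (pickP (fun j => (r *m cplx vM) 0 j != 0)) => [j rj|rvM0].
    have := congr1 (fun y : 'rV_p => y 0 j) rvE.
    rewrite /cplx map_diag_mx mul_mx_diag mxE [RHS]mxE [RHS]mulrC.
    by move/(mulfI rj); rewrite !mxE => <-; apply: Lambdag_Cg.
  have rvM : r *m cplx vM = 0.
    by apply/rowP => j; rewrite [RHS]mxE; apply/eqP; rewrite -[_ == _]negbK rvM0.
  apply: stg; apply/eigenvalueP; exists (r *m cplx bV).
    by rewrite -mulmxA -map_mxM -MbV map_mxM mulmxA rM scalemxAl.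
  apply: contra_neq r0 => rbV.
  rewrite -[r]mulmx1 -(map_mx1 rc) -TZ map_mxM map_row_mx mulmxA mul_mx_row.
  by rewrite [_ *m map_mx _ bV]rbV [_ *m map_mx _ vM]rvM row_mx0 mul0mx.
- rewrite /error_modes -/M -/E -[LHS]mulmx1 -[RHS]mulmx1 -TZ !mulmxA; congr (_ *m Z).
  rewrite -!mulmxA !mul_mx_row MbV MvM EbV mulmx0.
  rewrite [E *m (bV *m _)]mulmxA EbV mul0mx; congr row_mx.
  rewrite [E *m (vM *m _)]mulmxA; move: (E *m vM) EvM => W offW.
  apply/matrixP => i j; rewrite mul_mx_diag mul_diag_mx !mxE.
  have [->|/offW ->] := eqVneq i j; first by rewrite mulrC.
  by rewrite mul0r mulr0.
Qed.
End Synthesis.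

(** * Linear differential equations *)

Local Open Scope classical_set_scope.
Local Open Scope ring_scope.

Section LinearODE.
Variables (R : realType) (n : nat) (M : 'M[R]_n).

(** Coefficients of the [i]-th entry of [exp (t M) y] as a power series in [t]. *)
Definition expmx_coeff (y : 'cV[R]_n) (i : 'I_n) (k : nat) : R :=
  iter k (mulmx M) y i 0 / k`!%:R.

Lemma expmx_coeff_diffs y i :
  pseries_diffs (expmx_coeff y i) = expmx_coeff (M *m y) i.
Proof.
apply/funext => k; rewrite /pseries_diffs /expmx_coeff iterSr factS natrM.
by rewrite invfM mulrCA mulVKf // pnatr_eq0.
Qed.

Definition sum_norm (y : 'cV[R]_n) : R := \sum_i `|y i 0|.

Lemma iter_sum_norm y k :
  sum_norm (iter k (mulmx M) y) <= (\sum_i \sum_j `|M i j|) ^+ k * sum_norm y.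
Proof.
elim: k => [|k IHk]; first by rewrite expr0 mul1r.
rewrite /= exprS -mulrA; set z := iter k _ y in IHk *.
set c := \sum_i _ in IHk *.
have c0 : 0 <= c by apply: sumr_ge0 => i _; apply: sumr_ge0.
apply: le_trans (ler_wpM2l c0 IHk); rewrite mulr_suml; apply: ler_sum => i _.
rewrite mxE mulr_suml; apply: le_trans (ler_norm_sum _ _ _) _.
apply: ler_sum => j _; rewrite normrM ler_wpM2l //.
by rewrite /sum_norm (bigD1 j) //= lerDl sumr_ge0.
Qed.

Lemma cvg_expmx y i t : cvgn (pseries (expmx_coeff y i) t).
Proof.
apply: normed_cvg; set c := \sum_i \sum_j `|M i j|.
have c0 : 0 <= c by apply: sumr_ge0 => ? _; apply: sumr_ge0.
have y0 : 0 <= sum_norm y by apply: sumr_ge0.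
apply: (@series_le_cvg _ _ (sum_norm y *: exp_coeff (c * `|t|))) => [k|k|k|].
- exact: normr_ge0.
- by rewrite /exp_coeff mulr_ge0 // mulr_ge0 // ?invr_ge0 // exprn_ge0 // mulr_ge0.
- rewrite [leRHS](_ : _ = sum_norm y * ((c * `|t|) ^+ k / k`!%:R)) //.
  rewrite /expmx_coeff /= !normrM normrX normfV (ger0_norm (ler0n _ _)).
  rewrite exprMn mulrAC [leRHS]mulrA ler_wpM2r ?invr_ge0 // mulrA.
  rewrite ler_wpM2r ?exprn_ge0 // mulrC; apply: le_trans (iter_sum_norm y k).
  by rewrite /sum_norm (bigD1 i) //= lerDl sumr_ge0.
- exact/is_cvg_seriesZ/is_cvg_series_exp_coeff.
Qed.

Definition expmx_sol (y : 'cV[R]_n) (t : R) : 'cV[R]_n :=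
  \col_i limn (pseries (expmx_coeff y i) t).

Lemma expmx_sol0 y : expmx_sol y 0 = y.
Proof.
apply/colP => i; rewrite mxE; apply: lim_near_cst => //.
near=> k; rewrite -[k]prednK; last by near: k.
rewrite /pseries /series /= big_nat_recl //= expr0 mulr1 big1 ?addr0.
  by rewrite /expmx_coeff /= divr1.
by move=> j _; rewrite expr0n mulr0.
Unshelve. all: by end_near. Qed.

Lemma expmx_solM y t : expmx_sol (M *m y) t = M *m expmx_sol y t.
Proof.
apply/colP => i; rewrite !mxE; apply: cvg_lim => //.
have -> : pseries (expmx_coeff (M *m y) i) t =
    fun k => \sum_j M i j * pseries (expmx_coeff y j) t k.
  apply/funext => k; rewrite /pseries /series /=.
  under [RHS]eq_bigr do rewrite mulr_sumr.
  rewrite exchange_big; apply: eq_bigr => l _ /=.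
  rewrite /expmx_coeff -iterSr /= mxE !mulr_suml; apply: eq_bigr => j _.
  by rewrite !mulrA.
under eq_bigr do rewrite mxE.
apply: cvg_big => [|j _]; first exact: add_continuous.
apply: cvgMl_tmp; exact: cvg_expmx.
Qed.

Lemma is_derive_expmx_sol y i (t : R) :
  is_derive t 1 (fun s => expmx_sol y s i 0) ((M *m expmx_sol y t) i 0).
Proof.
rewrite -expmx_solM.
have -> : (fun s => expmx_sol y s i 0) = (fun s => limn (pseries (expmx_coeff y i) s)).
  by apply/funext => s; rewrite mxE.
rewrite mxE -expmx_coeff_diffs.
apply: (@pseries_snd_diffs _ _ (`|t| + 1)); rewrite ?expmx_coeff_diffs;
  try exact: cvg_expmx.
by rewrite [ltRHS]ger0_norm ?ltrDl // addr_ge0.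
Qed.

End LinearODE.

(** A two-sided derivative can be computed from the right. *)
Lemma is_derive_right0 (R : realType) (g : R -> R) (dg : R) :
  is_derive (0 : R) (1 : R) g dg -> (forall t : R, 0 <= t -> g t = 0) -> dg = 0.
Proof.
move=> [dervg <-] g0; rewrite /derive (cvg_at_rightE _ _ dervg).
apply: lim_near_cst => //; near=> h.
by rewrite /= addr0 [h *: 1]mulr1 !g0 ?subrr ?scaler0 //.
Unshelve. all: by end_near. Qed.

Lemma is_derive_expRM (R : realType) (l s : R) :
  is_derive s (1 : R) (fun t => expR (l * t)) (expR (l * s) * l).
Proof.
rewrite (_ : (fun t => _) = expR \o (l \*: (id : R -> R))) //.
apply: is_derive1_comp.
by have := is_deriveZ l (is_derive_id s (1 : R)); rewrite /GRing.scale /= mulr1.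
Qed.

(** [h t * expR (- l t)] has derivative zero on the open half-line and is
    continuous on the closed one. *)
Lemma scalar_decay (R : realType) (h : R -> R) (l : R) :
  {within `[0, +oo[, continuous h} ->
  (forall t : R, 0 < t -> is_derive t (1 : R) h (l * h t)) ->
  forall t : R, 0 <= t -> h t = h 0 * expR (l * t).
Proof.
move=> ch dh t; rewrite le_eqVlt => /predU1P[<-|t0]; first by rewrite mulr0 expR0 mulr1.
pose g s := h s * expR (- l * s).
suff gt : g t = g 0.
  have := congr1 (fun z => z * expR (l * t)) gt.
  by rewrite /g mulr0 expR0 mulr1 mulNr -mulrA -expRD addNr expR0 mulr1.
have dg (s : R) : s \in `]0, t[ -> is_derive s (1 : R) g 0.
  rewrite in_itv /= => /andP[s0 _].
  have := is_deriveM (dh s s0) (is_derive_expRM (- l) s).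
  rewrite /GRing.scale /=; congr (is_derive _ _ _ _).
  ring.
have ce : {within `[0, t], continuous (fun s => expR (- l * s))}.
  apply: derivable_within_continuous => s _.
  exact: (@ex_derive _ _ _ _ _ _ _ (is_derive_expRM (- l) s)).
have cg : {within `[0, t], continuous g}.
  have sub : `[0, t] `<=` `[0, +oo[.
    by move=> s /=; rewrite !in_itv /= andbT => /andP[].
  move=> s; apply: cvgM; [exact: (continuous_subspaceW sub ch)|exact: ce].
have [c _ /eqP] := MVT t0 dg cg.
by rewrite mul0r subr_eq0 => /eqP.
Qed.

(** * Tracking as an intertwining relation *)

Lemma mulmx_col_inj (K : comNzRingType) a b (P Q : 'M[K]_(a, b)) :
  (forall v : 'cV_b, P *m v = Q *m v) -> P = Q.
Proof.
move=> PQ; apply/matrixP => i j.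
have := congr1 (fun z : 'cV_a => z i 0) (PQ (delta_mx j 0)).
by rewrite -!colE !mxE.
Qed.

Lemma is_derive_mulmx (R : realType) a b (Q : 'M[R]_(a, b)) (x : R -> 'cV[R]_b)
    (dx : 'cV[R]_b) (t : R) k :
  (forall i, is_derive t (1 : R) (fun s => x s i 0) (dx i 0)) ->
  is_derive t (1 : R) (fun s => (Q *m x s) k 0) ((Q *m dx) k 0).
Proof.
move=> dxP; have -> : (fun s => (Q *m x s) k 0) = \sum_j (Q k j \*: (fun s => x s j 0)).
  by apply/funext => s; rewrite mxE fct_sumE.
rewrite mxE; apply: is_derive_sum => j; exact: is_deriveZ.
Qed.

Lemma within_continuous_mulmx (R : realType) a b (Q : 'M[R]_(a, b))
    (x : R -> 'cV[R]_b) (X : set R) k :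
  (forall i, {within X, continuous (fun s => x s i 0)}) ->
  {within X, continuous (fun s => (Q *m x s) k 0)}.
Proof.
move=> cx; have -> : (fun s => (Q *m x s) k 0) = fun s => \sum_j Q k j * x s j 0.
  by apply/funext => s; rewrite mxE.
move=> s; apply: cvg_big => [|j _]; first exact: add_continuous.
by apply: cvgMl_tmp; apply: cx.
Qed.

Section Tracking.
Variables (R : realType) (n m p : nat) (S : lti_system R n m p).
Variables (lam : 'I_p -> R) (F : 'M[R]_(m, n)).
Local Notation A := (sysA S).
Local Notation B := (sysB S).
Local Notation C := (sysC S).
Local Notation D := (sysD S).
Local Notation M := (A + B *m F).
Local Notation E := (C + D *m F).

Lemma error_modesP (v : 'cV_n) k : error_modes S lam F ->
  (E *m (M *m v)) k 0 = lam k * (E *m v) k 0.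
Proof. by move=> EM; rewrite mulmxA EM -mulmxA mul_diag_mx !mxE. Qed.

Lemma closed_loop_error (r : 'cV_p) (xss x : 'cV_n) (uss u : 'cV_m) (y : 'cV_p) :
  C *m xss + D *m uss = r -> u = F *m (x - xss) + uss ->
  y = C *m x + D *m u -> y - r = E *m (x - xss).
Proof.
move=> <- -> ->; rewrite mulmxDl -mulmxA [C *m (_ - _)]mulmxBr mulmxDr.
move: (C *m x) (C *m xss) (D *m uss) (D *m (F *m _)) => a b c d.
by rewrite addrA (addrC b) opprD addrA addrK addrAC.
Qed.

Lemma closed_loop_input (xss x : 'cV_n) (uss u : 'cV_m) :
  u = F *m (x - xss) + uss ->
  A *m x + B *m u = M *m (x - xss) + (A *m xss + B *m uss).
Proof.
move=> ->; rewrite mulmxDl -mulmxA [A *m (_ - _)]mulmxBr mulmxDr.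
by rewrite [RHS]addrACA subrK.
Qed.

(** Tracking applied to the zero reference says that [E exp (t M) v] is a scalar
    exponential entrywise; its right derivative at [0] gives [E M v = L E v].
    Conversely, under [E M = L E] every entry of the error solves a scalar
    equation. *)
Lemma ct_tracking_modes : ct_tracking ContinuousTime S lam F <-> error_modes S lam F.
Proof.
split=> [[beta track]|EM].
- apply: mulmx_col_inj => v; apply/colP => k.
  pose x := expmx_sol M v; pose u t := F *m x t; pose y t := C *m x t + D *m u t.
  have dx (t : R) i : is_derive t (1 : R) (fun s => x s i 0) ((M *m x t) i 0).
    exact: is_derive_expmx_sol.
  have errE t : 0 <= t -> (E *m x t) k 0 = beta v k * expR (lam k * t).
    have ss0 : steady_state ContinuousTime S 0 0 0.
      by split; rewrite !mulmx0 addr0.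
    have trj : ct_trajectory S x u.
      move=> i; split=> [|s _].
        by apply: derivable_within_continuous => s _; apply: ex_derive.
      by rewrite [_ + _](_ : _ = M *m x s) // mulmxDl mulmxA.
    have := track 0 0 0 ss0 x u y trj.
    rewrite [x 0]expmx_sol0 subr0 => + t0.
    move=> /(_ _ _ t t0 k); rewrite subr0 /y /u mulmxA -mulmxDl; apply => // s _.
    by rewrite subr0 addr0.
  have dg : is_derive (0 : R) (1 : R)
      (fun t => (E *m x t) k 0 - beta v k * expR (lam k * t))
      ((E *m (M *m x 0)) k 0 - beta v k * lam k).
    have := is_deriveB (is_derive_mulmx E k (dx 0))
      (is_deriveZ (beta v k) (is_derive_expRM (lam k) 0)).
    by rewrite mulr0 expR0 mul1r.
  have x0 : x 0 = v by apply: expmx_sol0.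
  have Ev := errE 0 (lexx 0); rewrite mulr0 expR0 mulr1 x0 in Ev.
  have /eqP : (E *m (M *m x 0)) k 0 - beta v k * lam k = 0.
    by apply: is_derive_right0 dg _ => t t0; rewrite errE // subrr.
  rewrite subr_eq0 x0 -Ev => /eqP EMv.
  by rewrite -mulmxA EMv -mulmxA mul_diag_mx !mxE mulrC.
- exists (fun v k => (E *m v) k 0) => r xss uss [ss rE] x u y trj uE yE t t0 k.
  rewrite (closed_loop_error rE (uE t t0) (yE t t0)).
  apply: (@scalar_decay _ (fun s => (E *m (x s - xss)) k 0)) => // [|s s0].
    apply: within_continuous_mulmx => i; have [ci _] := trj i.
    have -> : (fun s => (x s - xss) i 0) = (fun s => x s i 0) - cst (xss i 0).
      by apply/funext => s; rewrite !mxE.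
    apply: within_continuousB => //; apply: continuous_subspaceT; exact: cst_continuous.
  rewrite -error_modesP //; apply: is_derive_mulmx => i.
  have [_ /(_ s s0)] := trj i; rewrite (closed_loop_input (uE s (ltW s0))) ss addr0 => di.
  have := is_deriveB di (is_derive_cst (xss i 0) s (1 : R)); rewrite subr0.
  by congr (is_derive _ _ _ _); apply/funext => w; rewrite !mxE.
Qed.

(** The times [0] and [1] already give the intertwining relation. *)
Lemma dt_tracking_modes : dt_tracking DiscreteTime S lam F <-> error_modes S lam F.
Proof.
split=> [[beta track]|EM].
- apply: mulmx_col_inj => v; apply/colP => k.
  pose x t := iter t (mulmx M) v; pose u t := F *m x t; pose y t := C *m x t + D *m u t.
  have errE t : (E *m x t) k 0 = beta v k * lam k ^+ t.
    have ss0 : steady_state DiscreteTime S 0 0 0.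
      by split; rewrite !mulmx0 addr0.
    have trj : dt_trajectory S x u.
      by move=> s; rewrite /u mulmxA -mulmxDl.
    have := track 0 0 0 ss0 x u y trj.
    rewrite subr0 => /(_ _ _ t k); rewrite subr0 /y /u mulmxA -mulmxDl; apply => // s.
    by rewrite subr0 addr0.
  have := errE 1%N; have := errE 0%N; rewrite /x /= expr0 mulr1 expr1 => E0 E1.
  by rewrite -mulmxA E1 -mulmxA mul_diag_mx -E0 !mxE mulrC.
- exists (fun v k => (E *m v) k 0) => r xss uss [ss rE] x u y trj uE yE t k.
  rewrite (closed_loop_error rE (uE t) (yE t)).
  elim: t => [|t IHt]; first by rewrite expr0 mulr1.
  rewrite trj (closed_loop_input (uE t)) ss addrK error_modesP // IHt.
  by rewrite exprS mulrCA.
Qed.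

End Tracking.

(** * The solvability criterion *)

Theorem theorem1 (R : realType) (n m p : nat) (tm : time_domain)
    (Sigma : lti_system R n m p)
    (Hstanding : standing_assumptions Sigma)
    (H1 : assumption1 tm Sigma) (H2 : assumption2 tm Sigma)
    (Vg : {vspace 'cV[R]_n}) (HVg : is_Vstarg tm Sigma Vg)
    (HdimVg : (\dim Vg + p = n)%N)
    (lam : 'I_p -> R)
    (Hlam : forall j, Lambdag tm (lam j) /\
                      ~ invariant_zero Sigma (real_complex R (lam j))) :
  problem3_solvable tm Sigma lam <->
  (forall S : {set 'I_p},
     (n - p + #|S| <= \dim (Vg + \sum_(j in S) Rstar Sigma j (lam j))%VS)%N).
Proof.
have lamg j : Lambdag tm (lam j) by case: (Hlam j).
have lamZ j : ~ invariant_zero Sigma (real_complex R (lam j)) by case: (Hlam j).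
have [rinv _ _] := H1.
have dimVg : (n - p)%N = \dim Vg by rewrite -[in LHS]HdimVg addnK.
split.
- case=> F [stM track] J.
  suff EM : error_modes Sigma lam F by exact: error_modes_dim HVg HdimVg rinv lamZ stM EM.
  by case: (tm) track => [/ct_tracking_modes|/dt_tracking_modes].
- move=> dimJ.
  have [v vR le_n] : exists2 v : 'I_p -> 'cV[R]_n,
      forall j, v j \in Rstar Sigma j (lam j) &
      (\dim Vg + #|'I_p| <= \dim (Vg + \sum_j <[v j]>)%VS)%N.
    by apply: rado_subspaces; apply/forallP => J; rewrite -dimVg.
  rewrite card_ord HdimVg in le_n.
  have [F [stM EM]] := modes_feedback (proj1 HVg) HdimVg lamg vR le_n.
  exists F; split=> //.
  by case: (tm); [apply/ct_tracking_modes|apply/dt_tracking_modes].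
Qed.
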